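(* Let $X$ be a topological toric manifold of dimension $2n$, let $TX$ be its tangent bundle, let $\ell \geq 0$ be an integer, and let $\underline{\mathbb{R}}^{2\ell} = X \times \mathbb{R}^{2\ell}$ be the product bundle of rank $2\ell$ over $X$. If $J$ is a $(\mathbb{C}^* )^n$-invariant stably complex structure on $TX \oplus \underline{\mathbb{R}}^{2\ell}$, then $TX$ is a complex subbundle of $(TX \oplus \underline{\mathbb{R}}^{2\ell}, J)$, i.e. $J(T_xX \oplus 0) = T_xX \oplus 0$ for every $x \in X$. Namely, $X$ has a $(\mathbb{C}^* )^n$-invariant almost complex structure (the restriction of $J$ to $TX$).
   Context: $\mathbb{C}^* = \mathbb{C} \setminus \{0\}$, and $(\mathbb{C}^* )^n$ is regarded as a real Lie group. A topological toric manifold of dimension $2n$ is a smooth closed (compact, without boundary) manifold $X$ of real dimension $2n$ endowed with an effective smooth action of $(\mathbb{C}^* )^n$ which has an open dense orbit and which is locally equivariantly diffeomorphic to a smooth representation space of $(\mathbb{C}^* )^n$. That is, $X$ is covered by finitely many $(\mathbb{C}^* )^n$-invariant open subsets, each equivariantly diffeomorphic to a direct sum $\bigoplus_{i=1}^n V(\chi_i)$ of complex one-dimensional representation spaces, where each $\chi_i : (\mathbb{C}^* )^n \to \mathbb{C}^*$ is a smooth (not necessarily holomorphic or algebraic) group homomorphism and $V(\chi_i)$ is $\mathbb{C}$ with $g$ acting by multiplication by $\chi_i(g)$. The group $(\mathbb{C}^* )^n$ acts on $TX \oplus \underline{\mathbb{R}}^{2\ell}$ by the differential of the action on the summand $TX$,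 and on the product bundle $\underline{\mathbb{R}}^{2\ell} = X \times \mathbb{R}^{2\ell}$ by $g \cdot (x,v) = (g\cdot x, v)$. A $(\mathbb{C}^* )^n$-invariant stably complex structure on $TX \oplus \underline{\mathbb{R}}^{2\ell}$ is a smooth real vector bundle endomorphism $J$ of $TX \oplus \underline{\mathbb{R}}^{2\ell}$ covering the identity of $X$, with $J^2 = -\mathrm{id}$, which commutes with this action of $(\mathbb{C}^* )^n$. A $(\mathbb{C}^* )^n$-invariant almost complex structure on $X$ is a smooth bundle endomorphism $J$ of $TX$ with $J^2 = -\mathrm{id}$ commuting with the differential of the action of every $g \in (\mathbb{C}^* )^n$. *)

(* Defs.v *)
From HB Require Import structures.
From mathcomp Require Import all_boot all_order all_algebra.
From mathcomp Require Import all_classical all_reals all_analysis.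
From mathcomp Require Import complex.

Set Implicit Arguments.
Unset Strict Implicit.
Unset Printing Implicit Defensive.

Import Order.TTheory GRing.Theory Num.Theory.
Import numFieldNormedType.Exports.

Local Open Scope classical_set_scope.
Local Open Scope ring_scope.

(* C^k and C^oo maps between normed modules, on an open set [U].  In finite
   dimension, f is C^{k+1} iff it is differentiable and x |-> df_x(v) is C^k
   for every fixed vector v. *)

Fixpoint Ck (R : realType) (V W : normedModType R) (k : nat) (U : set V)
    (f : V -> W) : Prop :=
  match k with
  | 0%N => forall x, U x -> {for x, continuous f}
  | k'.+1 => (forall x, U x -> differentiable f x) /\
             forall v : V, Ck k' U (fun x => 'd f x v)
  end.

Definition smooth_on (R : realType) (V W : normedModType R) (U : set V)
    (f : V -> W) : Prop := forall k : nat, Ck k U f.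

(* A chart is a homeomorphism from an open set [cdom] onto an open subset of
   R^m.  [cmap] and [cinv] are total functions; their values outside [cdom] and
   outside the image of [cdom] carry no information. *)

Record chart (R : realType) (X : topologicalType) (m : nat) := Chart {
  cdom : set X;
  cmap : X -> 'rV[R]_m;
  cinv : 'rV[R]_m -> X;
  cdom_open : open cdom;
  cimg_open : open (cmap @` cdom);
  cmapK : forall x, cdom x -> cinv (cmap x) = x;
  cmap_continuous : forall x, cdom x -> {for x, continuous cmap};
  cinv_continuous : forall y, (cmap @` cdom) y -> {for y, continuous cinv}
}.

Definition cimg (R : realType) (X : topologicalType) (m : nat)
  (c : chart R X m) : set 'rV[R]_m := cmap c @` cdom c.

(* The atlas need not be maximal.  [chart_at x] is an arbitrary member of it
   defined at x; it only serves to represent tangent vectors, see [tangent]. *)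

Record smooth_manifold (R : realType) (m : nat) := SmoothManifold {
  mspace :> topologicalType;
  mspace_hausdorff : hausdorff_space mspace;
  mspace_second_countable : @second_countable mspace;
  atlas : set (chart R mspace m);
  chart_at : mspace -> chart R mspace m;
  chart_at_atlas : forall x, atlas (chart_at x);
  chart_at_dom : forall x, cdom (chart_at x) x;
  atlas_smooth : forall c d, atlas c -> atlas d ->
    smooth_on (cmap c @` (cdom c `&` cdom d)) (cmap d \o cinv c)
}.

Arguments atlas {R m} s _.
Arguments chart_at {R m s} _.

(* [U] and [W] are meant to be open. *)

Definition smooth_to (R : realType) (m : nat) (M : smooth_manifold R m)
    (V : normedModType R) (U : set M) (f : M -> V) : Prop :=
  forall c, atlas M c -> smooth_on (cmap c @` (cdom c `&` U)) (f \o cinv c).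

Definition smooth_from (R : realType) (m : nat) (M : smooth_manifold R m)
    (V : normedModType R) (W : set V) (f : V -> M) : Prop :=
  (forall v, W v -> {for v, continuous f}) /\
  forall c, atlas M c -> smooth_on (W `&` f @^-1` cdom c) (cmap c \o f).

(* A tangent vector at x is represented by its coordinates in [chart_at x]; its
   coordinates in any other chart c at x are obtained by [tchart c x], the
   differential of the transition map, with inverse [tchart_inv c x].  Thus
   (x, v) |-> (cmap c x, tchart c x v), for c in the atlas, are the bundle
   charts of TM. *)

Definition tangent (R : realType) (m : nat) (M : smooth_manifold R m) (x : M) :
  normedModType R := 'rV[R]_m.

Definition tchart (R : realType) (m : nat) (M : smooth_manifold R m)
    (c : chart R M m) (x : M) : tangent x -> 'rV[R]_m :=
  'd (cmap c \o cinv (chart_at x)) (cmap (chart_at x) x).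

Definition tchart_inv (R : realType) (m : nat) (M : smooth_manifold R m)
    (c : chart R M m) (x : M) : 'rV[R]_m -> tangent x :=
  'd (cmap (chart_at x) \o cinv c) (cmap c x).

Definition mdiff (R : realType) (m : nat) (M : smooth_manifold R m)
    (f : M -> M) (x : M) : tangent x -> tangent (f x) :=
  'd (cmap (chart_at (f x)) \o f \o cinv (chart_at x)) (cmap (chart_at x) x).

(* The identification C^n = R^(n+n), z |-> (Re z, Im z). *)

Definition complexify (R : realType) (n : nat) (v : 'rV[R]_(n + n)) :
  'rV[R[i]]_n := \row_j (v 0 (lshift n j) +i* v 0 (rshift n j))%C.

(* The group (C\{0})^n, as a subset of C^n with componentwise multiplication. *)

Definition torus (R : realType) (n : nat) : set 'rV[R[i]]_n :=
  [set g | forall j, g 0 j != 0].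

Definition torus_one (R : realType) (n : nat) : 'rV[R[i]]_n := const_mx 1.

Definition torus_mul (R : realType) (n : nat) (g h : 'rV[R[i]]_n) :
  'rV[R[i]]_n := \row_j (g 0 j * h 0 j).

Definition smooth_character (R : realType) (n : nat)
    (chi : 'rV[R[i]]_n -> R[i]) : Prop :=
  [/\ forall g, torus g -> chi g != 0,
      forall g h, torus g -> torus h ->
        chi (torus_mul g h) = chi g * chi h &
      smooth_on [set v : 'rV[R]_(n + n) | torus (complexify v)]
        (fun v => (complex.Re (chi (complexify v)) : R^o,
                   complex.Im (chi (complexify v)) : R^o))].

(* Smooth actions of (C\{0})^n; [a g] is only relevant for g in [torus].
   Smoothness is that of the map (C\{0})^n x M -> M, (g, x) |-> a g x, where
   (C\{0})^n is an open subset of R^(n+n). *)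

Definition torus_action (R : realType) (n m : nat) (M : smooth_manifold R m)
    (a : 'rV[R[i]]_n -> M -> M) : Prop :=
  (forall x, a (torus_one R n) x = x) /\
  (forall g h x, torus g -> torus h -> a (torus_mul g h) x = a g (a h x)).

Definition smooth_action (R : realType) (n m : nat) (M : smooth_manifold R m)
    (a : 'rV[R[i]]_n -> M -> M) : Prop :=
  (forall p : 'rV[R]_(n + n) * M, torus (complexify p.1) ->
     {for p, continuous
        (fun q : 'rV[R]_(n + n) * M => a (complexify q.1) q.2)}) /\
  (forall c d, atlas M c -> atlas M d ->
     smooth_on
       [set p : 'rV[R]_(n + n) * 'rV[R]_m |
          [/\ torus (complexify p.1), cimg c p.2 &
              cdom d (a (complexify p.1) (cinv c p.2))]]
       (fun p => cmap d (a (complexify p.1) (cinv c p.2)))).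

Definition effective_action (R : realType) (n m : nat)
    (M : smooth_manifold R m) (a : 'rV[R[i]]_n -> M -> M) : Prop :=
  forall g, torus g -> (forall x, a g x = x) -> g = torus_one R n.

Definition torus_orbit (R : realType) (n m : nat) (M : smooth_manifold R m)
  (a : 'rV[R[i]]_n -> M -> M) (x : M) : set M := (fun g => a g x) @` @torus R n.

(* U is invariant and (phi, psi) is an equivariant diffeomorphism between U and
   the direct sum of the V(chi_j), j < n, for some smooth characters chi_j. *)

Definition standard_piece (R : realType) (n : nat)
    (M : smooth_manifold R (n + n)) (a : 'rV[R[i]]_n -> M -> M)
    (U : set M) : Prop :=
  [/\ open U, (forall g x, torus g -> U x -> U (a g x)) &
   exists chi : 'I_n -> 'rV[R[i]]_n -> R[i],
   exists phi : M -> 'rV[R]_(n + n), exists psi : 'rV[R]_(n + n) -> M,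
   [/\ forall j, smooth_character (chi j),
       smooth_to U phi /\ smooth_from setT psi,
       forall x, U x -> psi (phi x) = x,
       forall y, U (psi y) /\ phi (psi y) = y &
       forall g x, torus g -> U x ->
         complexify (phi (a g x)) =
         \row_j (chi j g * complexify (phi x) 0 j)]].

Record topological_toric_manifold (R : realType) (n : nat) := TopologicalToric {
  tt_manifold :> smooth_manifold R (n + n);
  tt_act : 'rV[R[i]]_n -> tt_manifold -> tt_manifold;
  tt_compact : compact [set: tt_manifold];
  tt_action : torus_action tt_act;
  tt_smooth : smooth_action tt_act;
  tt_effective : effective_action tt_act;
  tt_orbit : exists x : tt_manifold,
    open (torus_orbit tt_act x) /\ dense (torus_orbit tt_act x);
  tt_local : exists (N : nat) (U : 'I_N -> set tt_manifold),
    (forall x, exists k, U k x) /\ (forall k, standard_piece tt_act (U k))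
}.

Arguments tt_act {R n} t _ _.

(* Complex structures on TM (+) R^k and on TM.  Smoothness of the endomorphism J
   is that of the induced self-map of the total space, read in the bundle charts
   (x, v, s) |-> (cmap c x, tchart c x v, s); the base component of this map is
   the identity, and is omitted. *)

Definition stably_complex_structure (R : realType) (m k : nat)
    (M : smooth_manifold R m)
    (J : forall x : M, tangent x * 'rV[R]_k -> tangent x * 'rV[R]_k) : Prop :=
  [/\ forall x, linear (J x),
      forall x p, J x (J x p) = - p &
      forall c, atlas M c ->
        smooth_on (cimg c `*` [set: 'rV[R]_m * 'rV[R]_k])
          (fun q : 'rV[R]_m * ('rV[R]_m * 'rV[R]_k) =>
             let x := cinv c q.1 in
             let p := J x (tchart_inv c x q.2.1, q.2.2) in
             (tchart c p.1, p.2))].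

Definition stably_complex_invariant (R : realType) (n m k : nat)
    (M : smooth_manifold R m) (a : 'rV[R[i]]_n -> M -> M)
    (J : forall x : M, tangent x * 'rV[R]_k -> tangent x * 'rV[R]_k) : Prop :=
  forall g x (p : tangent x * 'rV[R]_k), torus g ->
    J (a g x) (mdiff (a g) p.1, p.2) =
    (mdiff (a g) (J x p).1, (J x p).2).

Definition almost_complex_structure (R : realType) (m : nat)
    (M : smooth_manifold R m) (J : forall x : M, tangent x -> tangent x) :
    Prop :=
  [/\ forall x, linear (J x),
      forall x v, J x (J x v) = - v &
      forall c, atlas M c ->
        smooth_on (cimg c `*` [set: 'rV[R]_m])
          (fun q : 'rV[R]_m * 'rV[R]_m =>
             let x := cinv c q.1 in tchart c (J x (tchart_inv c x q.2)))].

Definition almost_complex_invariant (R : realType) (n m : nat)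
    (M : smooth_manifold R m) (a : 'rV[R[i]]_n -> M -> M)
    (J : forall x : M, tangent x -> tangent x) : Prop :=
  forall g x (v : tangent x), torus g ->
    J (a g x) (mdiff (a g) v) = mdiff (a g) (J x v).

(* Main.v *)
(** In a standard chart, an element g of the torus acts by the linear map
    L = diag (chi_j g).  Writing B_x : T_x X -> R^(2l) for the component of
    J_x (v, 0) in the trivial summand, invariance reads B_(L y) (L w) = B_y w in
    this chart.  As the open orbit is dense, some g makes L a contraction; then
    B_y w = B_(L^k y) (L^k w) tends to B_0 0 = 0: B = 0 and J preserves TX. *)

Require Import Defs.
From HB Require Import structures.
From mathcomp Require Import all_boot all_order all_algebra.
From mathcomp Require Import all_classical all_reals all_analysis.
From mathcomp Require Import complex ring lra.

Set Implicit Arguments.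
Unset Strict Implicit.
Unset Printing Implicit Defensive.

Import Order.TTheory GRing.Theory Num.Theory.
Import numFieldNormedType.Exports.

Local Open Scope classical_set_scope.
Local Open Scope ring_scope.

(** * Calculus: differentials, C^k maps, and the chain rule through a chart *)

Lemma diff_near_eq (R : realType) (V W : normedModType R) (f g : V -> W)
    (x : V) :
  (\forall z \near x, f z = g z) -> differentiable f x ->
  differentiable g x /\ 'd g x = 'd f x :> (V -> W).
Proof.
move=> fg df; have cdf := diff_continuous df.
(* The first-order expansion of [f] at [x] depends only on its germ, so it serves for [g];
   uniqueness of the differential then applies. *)
have go : g \o shift x = cst (g x) + 'd f x +o_ 0 id.
  have /diff_locally /eqaddoP fo := df.
  apply/eqaddoP => e e0; have := fo e e0.
  have fg0 : \forall h \near (0 : V), f (h + x) = g (h + x).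
    by have := fg; rewrite (near_shift 0) subr0.
  apply: filter_app; near=> h => /=.
  have fgh : f (h + x) = g (h + x) by near: h.
  by rewrite !fctE /= (nbhs_singleton fg) fgh.
have E : 'd g x = 'd f x :> (V -> W) by exact: diff_unique.
split; last exact: E.
by apply/diff_locallyP; rewrite E.
Unshelve. all: by end_near. Qed.

Lemma rV_linear_continuous (R : realType) (m : nat) (W : normedModType R)
    (f : {linear 'rV[R]_m -> W}) : continuous f.
Proof.
have -> : (f : _ -> _) = (fun v => \sum_(i < m) v ord0 i *: f (delta_mx 0 i)).
  apply/funext => v; rewrite {1}(row_sum_delta v) linear_sum.
  by apply: eq_bigr => i _; rewrite linearZ.
apply: continuous_big => [|i _]; first exact: add_continuous.
by move=> v; apply: (@cvgZr_tmp _ _ _ (nbhs v)); exact: coord_continuous.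
Qed.

Lemma Ck_eq (R : realType) (V W : normedModType R) (k : nat) (U : set V)
    (f g : V -> W) :
  open U -> (forall x, U x -> f x = g x) -> Ck k U f -> Ck k U g.
Proof.
move=> Uo; elim: k f g => [|k IH] f g fg /=.
  move=> fc x Ux.
  have fgn : \forall z \near x, f z = g z.
    by apply: filterS (open_nbhs_nbhs (conj Uo Ux)).
  have := fc x Ux; rewrite /prop_for /continuous_at -(fg x Ux).
  by apply: cvg_trans; exact: near_eq_cvg.
move=> [df dfk].
have dfg x : U x -> differentiable g x /\ 'd g x = 'd f x :> (V -> W).
  move=> Ux; apply: diff_near_eq; last exact: df.
  by apply: filterS (open_nbhs_nbhs (conj Uo Ux)).
split=> [x /dfg[]//|v]; apply: IH (dfk v) => x /dfg[_ E].
by rewrite E.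
Qed.

(** By induction on [k]: each directional derivative of [p \o f] is [p] composed with that of
    [f]. *)
Lemma Ck_linear_comp (R : realType) (V W W' : normedModType R) (k : nat)
    (U : set V) (f : V -> W) (p : {linear W -> W'}) :
  open U -> continuous p -> Ck k U f -> Ck k U (p \o f).
Proof.
move=> Uo pc; elim: k f => [|k IH] f /=.
  by move=> fc x Ux; apply: continuous_comp; [exact: fc|exact: pc].
move=> [df dfk].
have dp y : differentiable p y by exact: linear_differentiable.
split=> [x Ux|v]; first by apply: differentiable_comp; [exact: df|].
apply: (Ck_eq Uo _ (IH _ (dfk v))) => x Ux.
by rewrite diff_comp //=; [rewrite diff_lin|exact: df].
Qed.

(** By induction on [k]: the derivative of [f \o p] along [v] is the derivative of [f] along the
    fixed vector [p v], composed with [p]. *)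
Lemma Ck_comp_linear (R : realType) (V V' W : normedModType R) (k : nat)
    (U : set V) (f : V -> W) (p : {linear V' -> V}) :
  open U -> continuous p -> Ck k U f -> Ck k (p @^-1` U) (f \o p).
Proof.
move=> Uo pc; have Uo' : open (p @^-1` U) by exact: open_comp.
elim: k f => [|k IH] f /=.
  by move=> fc x Ux; apply: continuous_comp; [exact: pc|exact: fc].
move=> [df dfk].
have dp y : differentiable p y by exact: linear_differentiable.
split=> [x Ux|v]; first by apply: differentiable_comp; [|exact: df].
apply: (Ck_eq Uo' _ (IH _ (dfk (p v)))) => x Ux.
by rewrite diff_comp //=; [rewrite [in RHS]diff_lin|exact: df].
Qed.

(** [Ck 1] gives continuity of the differential only along each fixed vector. Expanding [w k] in the
    standard basis reduces the joint limit to finitely many such directions, with coefficients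
    tending to 0. *)
Lemma C1_diff_cvg0 (R : realType) (m : nat) (W : normedModType R)
    (U : set 'rV[R]_m) (f : 'rV[R]_m -> W) (x : 'rV[R]_m)
    (u w : nat -> 'rV[R]_m) :
  Ck 1 U f -> U x -> u k @[k --> \oo] --> x ->
  w k @[k --> \oo] --> (0 : 'rV[R]_m) ->
  'd f (u k) (w k) @[k --> \oo] --> (0 : W).
Proof.
move=> [_ df] Ux ux w0.
have -> : (fun k => 'd f (u k) (w k)) =
    (fun k => \sum_(i < m) w k ord0 i *: 'd f (u k) (delta_mx 0 i)).
  apply/funext => k; rewrite {1}(row_sum_delta (w k)) linear_sum.
  by apply: eq_bigr => i _; rewrite linearZ.
(* The limit 0 is generalized to [z], to be replaced by the sum of the termwise limits. *)
suff S z : \sum_(i < m) (0 : R) *: 'd f x (delta_mx 0 i) = z ->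
    \sum_(i < m) w k ord0 i *: 'd f (u k) (delta_mx 0 i) @[k --> \oo] --> z.
  by apply: S; apply: big1 => i _; exact: scale0r.
move=> <-.
apply: cvg_big => [|i _]; first exact: add_continuous.
apply: cvgZ.
  have := @continuous_cvg _ _ _ _ _ w (fun v : 'rV[R]_m => v ord0 i) _
    (@coord_continuous _ 1 m ord0 i (0 : 'rV[R]_m)) w0.
  by rewrite mxE; apply.
exact: (@continuous_cvg _ _ _ _ _ u (fun y => 'd f y (delta_mx 0 i)) _
  (df _ x Ux) ux).
Qed.

(** Near [v], the map [h \o f] agrees with [(h \o cinv c) \o (cmap c \o f)], a composite of maps
    between normed modules to which the usual chain rule applies. *)
Lemma diff_through_chart (R : realType) (m : nat) (X : topologicalType)
    (V W : normedModType R) (c : chart R X m) (f : V -> X) (h : X -> W)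
    (v : V) :
  {for v, continuous f} -> cdom c (f v) ->
  differentiable (cmap c \o f) v ->
  differentiable (h \o cinv c) (cmap c (f v)) ->
  differentiable (h \o f) v /\
  'd (h \o f) v = 'd (h \o cinv c) (cmap c (f v)) \o 'd (cmap c \o f) v
    :> (V -> W).
Proof.
move=> fc cfv df dh.
have [||dhf E] := @diff_near_eq R V W ((h \o cinv c) \o (cmap c \o f))
  (h \o f) v.
- have : nbhs (f v) (cdom c).
    by apply: open_nbhs_nbhs; split=> //; exact: cdom_open.
  by move=> /(fc _); apply: (@filterS _ (nbhs v)) => z cz /=; rewrite cmapK.
- exact: differentiable_comp.
by split=> //; rewrite E diff_comp.
Qed.

(** * Transition maps and coordinates of tangent vectors *)

Definition smooth_transition (R : realType) (X : topologicalType) (m : nat)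
    (c d : chart R X m) : Prop :=
  smooth_on (cmap c @` (cdom c `&` cdom d)) (cmap d \o cinv c).

Section transitions.
Context (R : realType) (X : topologicalType) (m : nat).
Implicit Types c d e : chart R X m.

Lemma transition_differentiable c d x :
  smooth_transition c d -> cdom c x -> cdom d x ->
  differentiable (cmap d \o cinv c) (cmap c x).
Proof. by move=> /(_ 1%N)[dcd _] cx dx; apply: dcd; exists x. Qed.

(** This is the cocycle rule of the tangent bundle, obtained from the chain rule through the middle
    chart [d]. *)
Lemma transition_chain c d e x v :
  smooth_transition c d -> smooth_transition d e ->
  cdom c x -> cdom d x -> cdom e x ->
  'd (cmap e \o cinv d) (cmap d x) ('d (cmap d \o cinv c) (cmap c x) v) =
  'd (cmap e \o cinv c) (cmap c x) v.
Proof.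
move=> cd de cx dx ex.
have ccx : cinv c (cmap c x) = x by exact: cmapK.
have [||||_ E] := @diff_through_chart R m X 'rV[R]_m 'rV[R]_m d (cinv c)
  (cmap e) (cmap c x).
- by apply: cinv_continuous; exists x.
- by rewrite ccx.
- exact: transition_differentiable.
- by rewrite ccx; exact: transition_differentiable.
by have /esym := congr1 (fun g => g v) E; rewrite /= ccx.
Qed.

Lemma transition_id c x v :
  cdom c x -> 'd (cmap c \o cinv c) (cmap c x) v = v.
Proof.
move=> cx.
have [||_ E] := @diff_near_eq R 'rV[R]_m 'rV[R]_m id (cmap c \o cinv c)
  (cmap c x).
- have : nbhs (cmap c x) (cmap c @` cdom c).
    by apply: open_nbhs_nbhs; split; [exact: cimg_open|exists x].
  by apply: filterS => _ [y cy <-] /=; rewrite cmapK.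
- by [].
apply: etrans (congr1 (fun g => g v) E) _.
by rewrite diff_val.
Qed.

End transitions.

Section tangent_coordinates.
Context (R : realType) (m : nat) (M : smooth_manifold R m).

(** The atlas need not be maximal, so the linearizing chart of a standard piece may lie outside it;
    this is membership in the maximal atlas. *)
Definition compatible_chart (e : chart R M m) : Prop :=
  forall c, atlas M c -> smooth_transition c e /\ smooth_transition e c.

Lemma atlas_compatible c : atlas M c -> compatible_chart c.
Proof. by move=> Ac d Ad; split; apply: (@atlas_smooth _ _ M). Qed.

Lemma tchartK e (x : M) (v : tangent x) :
  compatible_chart e -> cdom e x -> tchart_inv e x (tchart e v) = v.
Proof.
move=> /(_ _ (chart_at_atlas x))[ce ec] ex.
have cx := chart_at_dom x.
by rewrite /tchart_inv /tchart transition_chain // transition_id.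
Qed.

Lemma tchart_tchart_inv e c (x : M) (w : 'rV[R]_m) :
  compatible_chart e -> atlas M c -> cdom e x -> cdom c x ->
  tchart c (tchart_inv e x w) = 'd (cmap c \o cinv e) (cmap e x) w.
Proof.
move=> /(_ _ (chart_at_atlas x))[ce ec] Ac ex cx.
have Hx := chart_at_dom x.
have := atlas_compatible Ac (chart_at_atlas x).
by move=> [? _]; apply: (transition_chain (d := chart_at x)).
Qed.

Lemma tchart_invK e (x : M) (w : 'rV[R]_m) :
  compatible_chart e -> cdom e x -> tchart e (tchart_inv e x w) = w.
Proof.
move=> /(_ _ (chart_at_atlas x))[ce ec] ex.
have cx := chart_at_dom x.
by rewrite /tchart_inv /tchart transition_chain // transition_id.
Qed.

(** Where [f] reads as the linear map [L] in [e], its differential reads as [L] too. Since [mdiff]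
    is computed in the reference charts at [x] and [f x], the proof factors it through [e] on both
    sides. *)
Lemma mdiff_in_chart e (f : M -> M) (L : {linear 'rV[R]_m -> 'rV[R]_m})
    (x : M) w :
  compatible_chart e -> cdom e x -> cdom e (f x) ->
  (\forall y \near x, f y = cinv e (L (cmap e y))) ->
  cmap e (f x) = L (cmap e x) ->
  mdiff f (tchart_inv e x w) = tchart_inv e (f x) (L w).
Proof.
move=> eC ex efx fL Ex.
have [c1 c2] := eC _ (chart_at_atlas x).
have [d1 d2] := eC _ (chart_at_atlas (f x)).
have cx := chart_at_dom x.
have dx := chart_at_dom (f x).
set c := chart_at x in c1 c2 cx *; set d := chart_at (f x) in d1 d2 dx *.
have Lc := rV_linear_continuous (f := L).
have dL y : differentiable L y by exact: linear_differentiable.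
have dc : differentiable (cmap e \o cinv c) (cmap c x).
  exact: transition_differentiable.
have ccx : cinv c (cmap c x) = x by exact: cmapK.
have Pt : (L \o (cmap e \o cinv c)) (cmap c x) = cmap e (f x).
  by rewrite /= ccx Ex.
have dd : differentiable (cmap d \o cinv e)
    ((L \o (cmap e \o cinv c)) (cmap c x)).
  by rewrite Pt; exact: transition_differentiable.
have dLc : differentiable (L \o (cmap e \o cinv c)) (cmap c x).
  exact: differentiable_comp.
have Vt : 'd (L \o (cmap e \o cinv c)) (cmap c x) (tchart_inv e x w) = L w.
  apply: etrans (congr1 (fun g => g _) (diff_comp dc (dL _))) _.
  apply: etrans (congr1 (fun g => g _) (diff_lin _ Lc)) _.
  by congr (L _); exact: tchart_invK.
(* The map whose differential is [mdiff f] coincides near [cmap c x] with the factorization through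
   [e] and [L]. *)
have [||_ E] := @diff_near_eq R 'rV[R]_m 'rV[R]_m
  ((cmap d \o cinv e) \o (L \o (cmap e \o cinv c)))
  (cmap d \o f \o cinv c) (cmap c x).
- have cc : {for cmap c x, continuous (cinv c)}.
    by apply: cinv_continuous; exists x.
  have := cc (fun y => f y = cinv e (L (cmap e y))).
  by rewrite ccx => /(_ fL); apply: (@filterS _ (nbhs (cmap c x))) => z /= ->.
- exact: (differentiable_comp dLc dd).
apply: etrans (congr1 (fun g => g (tchart_inv e x w)) E) _.
apply: etrans (congr1 (fun g => g _) (diff_comp dLc dd)) _.
apply: etrans (congr1 ('d (cmap d \o cinv e) _) Vt) _.
exact: (congr1 (fun p => 'd (cmap d \o cinv e) p (L w)) Pt).
Qed.

End tangent_coordinates.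

(** * Complex diagonal operators on R^(n+n) and their contraction property *)

Section diagonal.
Context (R : realType) (n : nat).

Definition diag_op (a : 'I_n -> R[i]) (y : 'rV[R]_(n + n)) : 'rV[R]_(n + n) :=
  row_mx (\row_j complex.Re (a j * complexify y 0 j))
         (\row_j complex.Im (a j * complexify y 0 j)).

Lemma diag_op_lshift a y j : diag_op a y 0 (lshift n j) =
  complex.Re (a j) * y 0 (lshift n j) - complex.Im (a j) * y 0 (rshift n j).
Proof. by rewrite row_mxEl !mxE; case: (a j). Qed.

Lemma diag_op_rshift a y j : diag_op a y 0 (rshift n j) =
  complex.Re (a j) * y 0 (rshift n j) + complex.Im (a j) * y 0 (lshift n j).
Proof. by rewrite row_mxEr !mxE; case: (a j). Qed.

Lemma complexify_diag_op a y j :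
  complexify (diag_op a y) 0 j = a j * complexify y 0 j.
Proof.
rewrite mxE diag_op_lshift diag_op_rshift mxE; case: (a j) => p q /=.
by rewrite /GRing.mul /=; congr Complex; rewrite addrC mulrC.
Qed.

Lemma complexify_inj : injective (@complexify R n).
Proof.
move=> u v uv; apply/rowP => k; case: (split_ordP k) => j ->.
  by have := congr1 (fun w : 'rV__ => w 0 j) uv; rewrite !mxE => -[].
by have := congr1 (fun w : 'rV__ => w 0 j) uv; rewrite !mxE => -[].
Qed.

Lemma diag_op_is_linear a : linear (diag_op a).
Proof.
move=> k u v; apply/rowP => i.
have -> : (k *: diag_op a u + diag_op a v) 0 i =
    k * diag_op a u 0 i + diag_op a v 0 i.
  by rewrite mxE [X in X + _ = _]mxE.
by case: (split_ordP i) => j ->; rewrite ?diag_op_lshift ?diag_op_rshift !mxE;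
  ring.
Qed.

HB.instance Definition _ a := GRing.isLinear.Build R _ _ _ (diag_op a)
  (diag_op_is_linear a).

Lemma rV_norm_le (m : nat) (v : 'rV[R]_m) (r : R) :
  0 <= r -> (forall i, `|v 0 i| <= r) -> `|v| <= r.
Proof.
move=> r0 vr; rewrite [leLHS]/Num.Def.normr/= mx_normrE.
by apply: bigmax_le => // -[i j] _ /=; rewrite ord1.
Qed.

Lemma rV_coord_le_norm (m : nat) (v : 'rV[R]_m) i : `|v 0 i| <= `|v|.
Proof.
rewrite [leRHS]/Num.Def.normr/= mx_normrE.
exact: (le_bigmax _ (fun ij : 'I_1 * 'I_m => `|v ij.1 ij.2|) (0, i)).
Qed.

(** The norm is the sup norm, and each real coordinate of the image combines two coordinates of [y]
    with coefficients of size at most 1/4, whence the factor 1/4 + 1/4. *)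
Lemma diag_op_contraction a y :
  (forall j, `|complex.Re (a j)| <= 4%:R^-1 /\
             `|complex.Im (a j)| <= 4%:R^-1) ->
  `|diag_op a y| <= 2%:R^-1 * `|y|.
Proof.
move=> a4; apply: rV_norm_le; first by rewrite mulr_ge0.
have H (p q s t : R) : `|p| <= 4%:R^-1 -> `|q| <= 4%:R^-1 -> `|s| <= `|y| ->
   `|t| <= `|y| -> `|p * s + q * t| <= 2%:R^-1 * `|y|.
  move=> p4 q4 sy ty; apply: le_trans (ler_normD _ _) _; rewrite !normrM.
  have -> : 2%:R^-1 * `|y| = 4%:R^-1 * `|y| + 4%:R^-1 * `|y| by lra.
  by apply: lerD; apply: ler_pM.
move=> k; case: (split_ordP k) => j ->; have [re im] := a4 j.
  rewrite diag_op_lshift -mulNr; apply: H; rewrite ?normrN //;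
  exact: rV_coord_le_norm.
by rewrite diag_op_rshift; apply: H => //; exact: rV_coord_le_norm.
Qed.

Lemma iter_diag_op_cvg0 a y :
  (forall j, `|complex.Re (a j)| <= 4%:R^-1 /\
             `|complex.Im (a j)| <= 4%:R^-1) ->
  iter k (diag_op a) y @[k --> \oo] --> (0 : 'rV[R]_(n + n)).
Proof.
move=> a4.
have B k : `|iter k (diag_op a) y| <= `|y| * 2%:R^-1 ^+ k.
  elim: k => [|k IH]; first by rewrite expr0 mulr1.
  rewrite iterS; apply: le_trans (diag_op_contraction _ a4) _.
  by rewrite exprS mulrCA; apply: ler_wpM2l.
apply/cvgr0Pnorm_le => /= e e0.
have : `|y| * 2%:R^-1 ^+ k @[k --> \oo] --> (0 : R).
  rewrite -(mulr0 `|y|); apply: cvgMr; apply: cvg_expr.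
  by rewrite ger0_norm //; lra.
move=> /cvgr0Pnorm_le /(_ e e0).
apply: filterS => k; apply: le_trans; apply: le_trans (B k) _.
exact: ler_norm.
Qed.

End diagonal.

(** * Linearizing charts and a contracting torus element *)

Section standard_charts.
Context (R : realType) (n : nat) (M : smooth_manifold R (n + n))
  (a : 'rV[R[i]]_n -> M -> M).

Lemma smooth_to_continuous (V : normedModType R) (U : set M) (f : M -> V) x :
  open U -> smooth_to U f -> U x -> {for x, continuous f}.
Proof.
move=> Uo fU Ux; set c := chart_at x.
have cx : cdom c x := chart_at_dom x.
have fc : {for cmap c x, continuous (f \o cinv c)}.
  by apply: (fU c (chart_at_atlas x) 0%N); exists x.
have : {for x, continuous ((f \o cinv c) \o cmap c)}.
  by apply: continuous_comp; [exact: cmap_continuous|exact: fc].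
rewrite /prop_for /continuous_at /= cmapK //.
apply: cvg_trans; apply: near_eq_cvg.
have : nbhs x (cdom c) by apply: open_nbhs_nbhs; split=> //; exact: cdom_open.
by apply: filterS => y cy; rewrite /= cmapK.
Qed.

(** The equivariant diffeomorphism [(phi, psi)] is itself a chart, with image all of R^(n+n).
    Smoothness of [phi] and of [psi] gives the two halves of compatibility. *)
Lemma standard_piece_chart (U : set M) : standard_piece a U ->
  exists (e : chart R M (n + n)) (chi : 'I_n -> 'rV[R[i]]_n -> R[i]),
  [/\ cdom e = U, compatible_chart e,
      forall y, U (cinv e y) /\ cmap e (cinv e y) = y,
      forall g x, torus g -> U x -> U (a g x) &
      forall g x, torus g -> U x ->
        cmap e (a g x) = diag_op (chi^~ g) (cmap e x)].
Proof.
move=> [Uo Ua [chi [phi [psi [_ [phis [psic psis]] psiK phiK phia]]]]].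
have phiU : phi @` U = setT.
  by apply/seteqP; split=> // y _; have [? ?] := phiK y; exists (psi y).
have oU : open (phi @` U) by rewrite phiU; exact: openT.
have cphi x : U x -> {for x, continuous phi}.
  by move=> Ux; apply: smooth_to_continuous Ux.
have cpsi y : (phi @` U) y -> {for y, continuous psi} by move=> _; exact: psic.
exists (Chart Uo oU psiK cphi cpsi), chi; split=> //.
- move=> c Ac; split; first exact: phis.
  rewrite /smooth_transition /= (_ : phi @` _ = setT `&` psi @^-1` cdom c).
    exact: psis.
  apply/seteqP; split=> [_ [x [Ux cx] <-]|y [_ cy]].
    by split=> //=; rewrite psiK.
  by have [? ?] := phiK y; exists (psi y).
- move=> g x tg Ux /=; apply: complexify_inj; rewrite phia //.
  by apply/rowP => j; rewrite complexify_diag_op mxE.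
Qed.

(** Translate back by the coordinatewise inverse of [g]. *)
Lemma invariant_of_torus_translate (U : set M) (g : 'rV[R[i]]_n) (x : M) :
  torus_action a -> (forall g x, torus g -> U x -> U (a g x)) ->
  torus g -> U (a g x) -> U x.
Proof.
move=> [a1 aM] Ua tg Ugx; pose h : 'rV[R[i]]_n := \row_j (g 0 j)^-1.
have th : torus h by move=> j; rewrite mxE invr_eq0.
rewrite -(a1 x) (_ : torus_one R n = torus_mul h g); last first.
  by apply/rowP => j; rewrite !mxE mulVf.
by rewrite aM //; exact: Ua.
Qed.

(* For z in the dense orbit, g z comes arbitrarily close to the origin of the
   chart, hence so does (chi_j g)_j = ((g z)_j / z_j)_j. *)
Lemma contracting_element (e : chart R M (n + n)) (U : set M)
    (chi : 'I_n -> 'rV[R[i]]_n -> R[i]) :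
  torus_action a -> (exists x, dense (torus_orbit a x)) ->
  cdom e = U -> (forall y, U (cinv e y) /\ cmap e (cinv e y) = y) ->
  (forall g x, torus g -> U x -> U (a g x)) ->
  (forall g x, torus g -> U x ->
     cmap e (a g x) = diag_op (chi^~ g) (cmap e x)) ->
  exists2 g, torus g & forall j,
    `|complex.Re (chi j g)| <= 4%:R^-1 /\ `|complex.Im (chi j g)| <= 4%:R^-1.
Proof.
move=> aact [z dz] eU eK Ua ea.
(* As [e] maps onto R^(n+n), the preimage of [W] is open and nonempty in the manifold, so the dense
   orbit meets it. *)
have orbit_meets (W : set 'rV[R]_(n + n)) : open W -> W !=set0 ->
    exists g, [/\ torus g, U (a g z) & W (cmap e (a g z))].
  move=> Wo [w Ww].
  have [||x [[Ux Wx] [g tg gz]]] := dz (U `&` cmap e @^-1` W).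
  - by exists (cinv e w); have [? E] := eK w; split=> //=; rewrite E.
  - rewrite openE => x [Ux Wx]; apply: filterI.
      by apply: open_nbhs_nbhs; split=> //; rewrite -eU; exact: cdom_open.
    apply: (@cmap_continuous _ _ _ e x); first by rewrite eU.
    exact: open_nbhs_nbhs.
  by exists g; rewrite gz.
have Uz : U z.
  have [g [tg Ug _]] := orbit_meets setT openT (ex_intro _ 0 I).
  exact: invariant_of_torus_translate Ug.
pose zc := complexify (cmap e z).
(* If this coordinate of [z] vanished, it would vanish at every [a g z], and the orbit would miss
   the open unit ball around the all-ones vector. *)
have zc0 j : zc 0 j != 0.
  have [||g [tg Ug]] := orbit_meets (ball (const_mx 1 : 'rV[R]_(n + n)) 1).
  - exact: ball_open.
  - by exists (const_mx 1); exact: ballxx.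
  rewrite ea // -ball_normE /= => B; apply/eqP => zj0.
  have := le_lt_trans (rV_coord_le_norm _ (lshift n j)) B.
  rewrite mxE [X in X + _]mxE [X in _ + X]mxE.
  have := complexify_diag_op (chi^~ g) (cmap e z) j.
  rewrite -/zc zj0 mulr0 mxE => -[-> _].
  by rewrite subr0 normr1 ltxx.
(* [D] divides by the coordinates of [z], so it sends the coordinates of [a g z] to the numbers
   [chi j g]. The radius 1/4 below is the bound that the contraction estimate requires. *)
pose D := diag_op (fun j => (zc 0 j)^-1).
have [||g [tg Ug Bg]] :=
  orbit_meets (D @^-1` ball (0 : 'rV[R]_(n + n)) 4%:R^-1).
- apply: open_comp; last exact: ball_open.
  by move=> y _; exact: rV_linear_continuous.
- by exists 0; rewrite /= /D linear0; exact: ballxx.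
exists g => // j; move: Bg; rewrite /= -ball_normE /= sub0r normrN ea // => Bg.
have Dchi : complexify (D (diag_op (chi^~ g) (cmap e z))) 0 j = chi j g.
  by rewrite !complexify_diag_op mulrCA -/zc mulVf ?mulr1.
rewrite -Dchi mxE /=.
by split; apply: le_trans (rV_coord_le_norm _ _) (ltW Bg).
Qed.

End standard_charts.

(** * The component of J from TX to the trivial summand, and its vanishing *)

Lemma cvg_seq_pair (R : realType) (V W : normedModType R) (f : nat -> V)
    (g : nat -> W) (v : V) (w : W) :
  f j @[j --> \oo] --> v -> g j @[j --> \oo] --> w ->
  (f j, g j) @[j --> \oo] --> (v, w).
Proof. exact: cvg_pair. Qed.

Section normal_component.
Context (R : realType) (n k : nat) (M : smooth_manifold R (n + n))
  (J : forall x : M, tangent x * 'rV[R]_k -> tangent x * 'rV[R]_k).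

(** This is B_y w, with base point and tangent vector both read in the chart [e]. *)
Definition normal_part (e : chart R M (n + n)) (y w : 'rV[R]_(n + n)) :
  'rV[R]_k := (J (tchart_inv e (cinv e y) w, 0)).2.

(** The torus acts trivially on the second summand, so the second component of the invariance
    identity carries no action on its value; on tangent vectors, g acts as [L] in the chart. *)
Lemma normal_part_invariant (a : 'rV[R[i]]_n -> M -> M)
    (e : chart R M (n + n)) (U : set M) (g : 'rV[R[i]]_n)
    (L : {linear 'rV[R]_(n + n) -> 'rV[R]_(n + n)}) :
  stably_complex_invariant a J -> compatible_chart e -> cdom e = U ->
  (forall y, U (cinv e y) /\ cmap e (cinv e y) = y) -> torus g ->
  (forall x, U x -> U (a g x)) ->
  (forall x, U x -> cmap e (a g x) = L (cmap e x)) ->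
  forall y w, normal_part e (L y) (L w) = normal_part e y w.
Proof.
move=> Jinv eC eU eK tg Ua ea y w.
have [Ux exy] := eK y; set x := cinv e y in Ux exy.
have agx z : U z -> a g z = cinv e (L (cmap e z)).
  by move=> Uz; rewrite -ea // cmapK // eU; exact: Ua.
have E : mdiff (a g) (tchart_inv e x w) = tchart_inv e (a g x) (L w).
  apply: mdiff_in_chart; rewrite ?eU //; [exact: Ua| |exact: ea].
  have : nbhs x U.
    by apply: open_nbhs_nbhs; split=> //; rewrite -eU; exact: cdom_open.
  by apply: filterS => z /agx.
have Ly : cinv e (L y) = a g x by rewrite agx // exy.
(* Tangent vectors depend on their base point: abstracting over [z] permits the replacement of
   [cinv e (L y)] by [a g x]. *)
pose B z (v : tangent z) := (@J z (v, 0)).2.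
apply: etrans (congr1 (fun z => B z (tchart_inv e z (L w))) Ly) _.
apply: etrans (congr1 (B (a g x)) (esym E)) _.
exact: (congr1 snd (Jinv g x (tchart_inv e x w, 0) tg)).
Qed.

(** Smoothness of [J] is given in atlas charts only, so one passes from [e] to an atlas chart [c] at
    the origin of [e]. There the expression is continuous and vanishes at the zero vector, and the
    transition carries [(u j, w j)] to a sequence converging to that point. *)
Lemma normal_part_cvg0 (e : chart R M (n + n))
    (u w : nat -> 'rV[R]_(n + n)) :
  stably_complex_structure J -> compatible_chart e ->
  (forall y, cdom e (cinv e y) /\ cmap e (cinv e y) = y) ->
  u j @[j --> \oo] --> (0 : 'rV[R]_(n + n)) ->
  w j @[j --> \oo] --> (0 : 'rV[R]_(n + n)) ->
  normal_part e (u j) (w j) @[j --> \oo] --> (0 : 'rV[R]_k).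
Proof.
move=> J_complex eC eK u0 w0.
have [ex0 ee0] := eK 0; set x0 := cinv e 0 in ex0 ee0.
set c := chart_at x0.
have Ac : atlas M c := chart_at_atlas x0.
have cx0 : cdom c x0 := chart_at_dom x0.
have [Jlin _ Jsm] := J_complex.
pose F (q : 'rV[R]_(n + n) * ('rV[R]_(n + n) * 'rV[R]_k)) :=
  let x := cinv c q.1 in let p := J (tchart_inv c x q.2.1, q.2.2) in
  ((tchart c p.1, p.2) : 'rV[R]_(n + n) * 'rV[R]_k).
pose q0 : 'rV[R]_(n + n) * ('rV[R]_(n + n) * 'rV[R]_k) := (cmap c x0, (0, 0)).
have Fc : {for q0, continuous F}.
  by apply: (Jsm c Ac 0%N); split=> //; exists x0.
have Fq0 : (F q0).2 = 0.
  have J0 x : J (0 : tangent x * 'rV[R]_k) = 0.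
    by have := Jlin x (-1) 0 0; rewrite scaler0 add0r scaleN1r addNr.
  have E : tchart_inv c (cinv c (cmap c x0)) 0 = 0 by exact: linear0.
  have := congr1 snd (J0 (cinv c (cmap c x0))).
  exact: etrans (congr1 (fun v : tangent (cinv c (cmap c x0)) =>
    (J (v, 0)).2) E).
have [_ ec] := eC c Ac.
pose T := cmap c \o cinv e.
have S0 : (cmap e @` (cdom e `&` cdom c)) 0 by exists x0.
have dT : {for (0 : 'rV[R]_(n + n)), continuous T}.
  by have := ec 0%N => /(_ 0 S0).
have Tu : T (u j) @[j --> \oo] --> cmap c x0.
  exact: (@continuous_cvg _ _ _ _ _ u T _ dT u0).
have dTu : 'd T (u j) (w j) @[j --> \oo] --> (0 : 'rV[R]_(n + n)).
  exact: (C1_diff_cvg0 (ec 1%N) S0 u0 w0).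
have G z : (F q0).2 = z ->
    (F (T (u j), ('d T (u j) (w j), 0))).2 @[j --> \oo] --> z.
  move=> <-.
  have H : (T (u j), ('d T (u j) (w j), 0 : 'rV[R]_k)) @[j --> \oo] --> q0.
    have H0 : (fun _ : nat => 0 : 'rV[R]_k) @ \oo --> (0 : 'rV[R]_k).
      exact: cvg_cst.
    exact: (cvg_seq_pair Tu (cvg_seq_pair dTu H0)).
  have F2c : {for q0, continuous (fun q => (F q).2)}.
    by apply: continuous_comp; [exact: Fc|exact: cvg_snd].
  exact: (@continuous_cvg _ _ _ _ _ _ (fun q => (F q).2) _ F2c H).
apply: cvg_trans (G _ Fq0); apply: near_eq_cvg.
(* The formula in [c] is valid only inside its domain, which contains the points eventually. *)
have cu : \forall j \near \oo, cdom c (cinv e (u j)).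
  have ce : {for (0 : 'rV[R]_(n + n)), continuous (cinv e)}.
    by apply: cinv_continuous; exists x0.
  have := @continuous_cvg _ _ _ _ _ u (cinv e) _ ce u0.
  by apply; apply: open_nbhs_nbhs; split=> //; exact: cdom_open.
apply: filterS cu => j cj; have [ej euj] := eK (u j).
rewrite /F /normal_part /= /T /= cmapK //.
have := tchart_tchart_inv (w j) eC Ac ej cj; rewrite euj => <-.
by rewrite tchartK //; exact: atlas_compatible.
Qed.

End normal_component.

Lemma normal_component_eq0 (R : realType) (n k : nat)
    (X : topological_toric_manifold R n)
    (J : forall x : X, tangent x * 'rV[R]_k -> tangent x * 'rV[R]_k) :
  stably_complex_structure J -> stably_complex_invariant (tt_act X) J ->
  forall (x : X) (v : tangent x), (J x (v, 0)).2 = 0.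
Proof.
move=> Jc Jinv x v.
have [N [U [Ucov Ustd]]] := tt_local X.
have [i Ux] := Ucov x.
have [e [chi [eU eC eK Ua ea]]] := standard_piece_chart (Ustd i).
have [z [_ dz]] := tt_orbit X.
have [g tg chi4] := contracting_element (@tt_action _ _ X) (ex_intro _ z dz)
  eU eK Ua ea.
set L := diag_op (chi^~ g).
have NL y w : normal_part J e (L y) (L w) = normal_part J e y w.
  apply: (normal_part_invariant (a := tt_act X) Jinv eC eU eK tg) =>
    [t Ut|t Ut].
    exact: Ua.
  exact: ea.
have NLk y w j : normal_part J e y w =
    normal_part J e (iter j L y) (iter j L w).
  by elim: j => // j ->; rewrite !iterS NL.
have N0 y w : normal_part J e y w = 0.
  have eK' t : cdom e (cinv e t) /\ cmap e (cinv e t) = t by rewrite eU.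
  have := normal_part_cvg0 Jc eC eK' (iter_diag_op_cvg0 y chi4)
    (iter_diag_op_cvg0 w chi4).
  (* By invariance the sequence is constant, so its value equals its limit 0. *)
  rewrite (_ : (fun j => _) = fun=> normal_part J e y w); last first.
    by apply/funext => j; rewrite -NLk.
  by move=> H; apply: (cvg_unique _ (cvg_cst _) H).
have ex : cdom e x by rewrite eU.
have xe : cinv e (cmap e x) = x by exact: cmapK.
pose B z (v : tangent z) := (@J z (v, 0)).2.
apply: etrans (congr1 (B x) (esym (tchartK v eC ex))) _.
apply: etrans (congr1 (fun z => B z (tchart_inv e z (tchart e v))) (esym xe)) _.
exact: N0.
Qed.

(** * Restriction of J to TX *)

(** The restricted map is [f] composed on both sides with continuous linear maps: the inclusion (v,
    w) |-> (v, (w, 0)) and the first projection. *)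
Lemma smooth_on_tangent_part (R : realType) (V W S V' S' : normedModType R)
    (U : set V) (f : V * (W * S) -> V' * S') :
  open U -> smooth_on (U `*` [set: W * S]) f ->
  smooth_on (U `*` [set: W]) (fun q => (f (q.1, (q.2, 0))).1).
Proof.
move=> Uo fs k.
pose q (u : V * W) := (u.1, (u.2, 0 : S)).
have ql : linear q.
  move=> r u v; rewrite -[RHS]/(r *: u.1 + v.1, (r *: u.2 + v.2, r *: 0 + 0)).
  by rewrite scaler0 addr0.
pose qL : {linear (V * W)%type -> (V * (W * S))%type} :=
  HB.pack q (GRing.isLinear.Build _ _ _ _ q ql).
pose pL : {linear (V' * S')%type -> V'} := fst.
have qc : continuous q.
  have c1 : continuous (fun u : V * W => u.1) by move=> u; exact: cvg_fst.
  have c2 : continuous (fun u : V * W => u.2) by move=> u; exact: cvg_snd.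
  have c0 : continuous (fun _ : V * W => 0 : S) by move=> u; exact: cvg_cst.
  by move=> u; exact: (cvg_pair (c1 u) (cvg_pair (c2 u) (c0 u))).
have Uo' : open (U `*` [set: W * S]).
  by rewrite setXT; apply: open_comp => // u _; exact: cvg_fst.
have pc : continuous pL by move=> u; exact: cvg_fst.
exact: (Ck_comp_linear (p := qL) Uo' qc (Ck_linear_comp Uo' pc (fs k))).
Qed.

Unset Implicit Arguments.

Theorem theorem1p1 (R : realType) (n l : nat)
    (X : topological_toric_manifold R n)
    (J : forall x : X, tangent x * 'rV[R]_(2 * l) -> tangent x * 'rV[R]_(2 * l))
    (J_complex : stably_complex_structure J)
    (J_invariant : stably_complex_invariant (tt_act X) J) :
  (forall x : X,
     J x @` [set p | p.2 = 0] = [set p : tangent x * 'rV[R]_(2 * l) | p.2 = 0]) /\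
  (let JT := fun (x : X) (v : tangent x) => (J x (v, 0)).1 in
   almost_complex_structure JT /\ almost_complex_invariant (tt_act X) JT).
Proof.
have J2 := normal_component_eq0 J_complex J_invariant.
have [Jlin JJ Jsm] := J_complex.
have J1 (x : X) (v : tangent x) : J x (v, 0) = ((J x (v, 0)).1, 0).
  by rewrite [LHS]surjective_pairing J2.
split=> [x|JT].
  apply/seteqP; split=> [_ [[v s] /= -> <-]|[v s] /= ->]; first exact: J2.
  (* Since J^2 = -1, the preimage of (v, 0) is -J(v, 0), which lies in TX again. *)
  exists (J x (- v, 0)); first exact: J2.
  by rewrite JJ; congr pair; rewrite ?opprK ?oppr0.
split; last first.
  move=> g x v tg.
  exact: (congr1 fst (J_invariant g x (v, 0) tg)).
split.
- move=> x k u v; rewrite /JT.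
  have E : (k *: u + v, 0) = k *: (u, 0) + (v, 0) :> tangent x * 'rV[R]_(2 * l).
    by rewrite -[RHS]/(k *: u + v, k *: 0 + 0) scaler0 addr0.
  by rewrite E Jlin.
- by move=> x v; rewrite /JT -J1 JJ.
- move=> c Ac.
  exact: (smooth_on_tangent_part (@cimg_open _ _ _ c) (Jsm c Ac)).
Qed.
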